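(* Let $\rho$ be a density operator on $\mathbb{C}^d$. Suppose that $\rho$ can be written as a (nontrivial) convex combination of an incoherent state and a coherent state, i.e. $\rho=\lambda\sigma+(1-\lambda)\tau$ with $0<\lambda<1$, $\sigma$ an incoherent state and $\tau$ a coherent state. Then $\rho$ cannot be deterministically purified via any free operation of the resource theory of coherence: there is no free operation $\Lambda$ such that $\Lambda(\rho)$ is a pure coherent state.
   Context: Fix a reference orthonormal basis $\{|i\rangle\}_{i=0}^{d-1}$ of the $d$-dimensional Hilbert space $\mathbb{C}^d$. A state (density operator) is incoherent if it is diagonal in this basis, i.e. of the form $\sum_{i=0}^{d-1}p_i|i\rangle\langle i|$; the set of incoherent states is denoted $\mathcal{I}$. A state that is not incoherent is called coherent. A pure coherent state is a rank-one projector $|\psi\rangle\langle\psi|$ that is coherent. Free operations of the resource theory of coherence are completely positive trace-preserving maps $\Lambda$ on operators on $\mathbb{C}^d$ belonging to one of the usual classes: maximally incoherent operations (MIO), i.e. those with $\Lambda(\mathcal{I})\subseteq\mathcal{I}$; incoherent operations (IO), i.e. those with a Kraus representation $\Lambda(\rho)=\sum_{n=1}^N K_n\rho K_n^\dagger$, $\sum_n K_n^\dagger K_n=I$, in which each $K_n$ maps incoherent states to (unnormalized) incoherent states; strictly incoherent operations (SIO), i.e. IO for which in addition each $K_n^\dagger$ maps incoherent states to (unnormalized) incoherent states; and further subclasses such as genuinely incoherent (GIO) and physical incoherent (PIO) operations. All these classes are contained in MIO, so ''any free operation'' means any completely positive trace-preserving map $\Lambda$ with $\Lambda(\mathcal{I})\subseteq\mathcal{I}$.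 Deterministic purification of $\rho$ means the existence of a free operation $\Lambda$ such that $\Lambda(\rho)$ is a pure coherent state. *)

(* Defs.v *)
From HB Require Import structures.
From mathcomp Require Import all_boot all_order all_algebra.
From mathcomp Require Import sesquilinear spectral.
From mathcomp Require Import reals complex.

Set Implicit Arguments.
Unset Strict Implicit.
Unset Printing Implicit Defensive.

Import Order.TTheory GRing.Theory Num.Theory.
Local Open Scope ring_scope.
Local Open Scope sesquilinear_scope.
Local Open Scope complex_scope.

(* The ket |v> is the column vector v and the bra <v| is v ^t*. *)

Definition orthonormal_basis (R : realType) (d : nat)
    (e : 'I_d -> 'cV[R[i]]_d) : Prop :=
  forall i j, (e i) ^t* *m e j = (i == j)%:R%:M.

(* On R[i] the order is partial: 0 <= z says that z is real and nonnegative.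
   Hence A is automatically Hermitian. *)
Definition psdmx (R : realType) (n : nat) (A : 'M[R[i]]_n) : Prop :=
  forall v : 'cV[R[i]]_n, 0 <= (v ^t* *m A *m v) ord0 ord0.

Definition density (R : realType) (d : nat) (rho : 'M[R[i]]_d) : Prop :=
  psdmx rho /\ \tr rho = 1.

Definition incoherent (R : realType) (d : nat) (e : 'I_d -> 'cV[R[i]]_d)
    (rho : 'M[R[i]]_d) : Prop :=
  density rho /\
  exists p : 'I_d -> R, rho = \sum_(i < d) (p i)%:C *: (e i *m (e i) ^t*).

Definition coherent (R : realType) (d : nat) (e : 'I_d -> 'cV[R[i]]_d)
    (rho : 'M[R[i]]_d) : Prop :=
  density rho /\ ~ incoherent e rho.

Definition pure (R : realType) (d : nat) (rho : 'M[R[i]]_d) : Prop :=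
  exists psi : 'cV[R[i]]_d, psi ^t* *m psi = 1%:M /\ rho = psi *m psi ^t*.

Definition pure_coherent (R : realType) (d : nat) (e : 'I_d -> 'cV[R[i]]_d)
    (rho : 'M[R[i]]_d) : Prop :=
  pure rho /\ coherent e rho.

(* Operators on C^k (x) C^d are k x k block matrices with d x d blocks; on them
   id_k (x) Lambda applies Lambda to every block. *)
Definition ampliation (R : realType) (d k : nat)
    (Lambda : 'M[R[i]]_d -> 'M[R[i]]_d) (X : 'M[R[i]]_(\sum_(a < k) d)) :
    'M[R[i]]_(\sum_(a < k) d) :=
  \mxblock_(a < k, b < k) Lambda (submxblock X a b).

Definition completely_positive (R : realType) (d : nat)
    (Lambda : 'M[R[i]]_d -> 'M[R[i]]_d) : Prop :=
  forall (k : nat) (X : 'M[R[i]]_(\sum_(a < k) d)),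
    psdmx X -> psdmx (ampliation Lambda X).

Definition trace_preserving (R : realType) (d : nat)
    (Lambda : 'M[R[i]]_d -> 'M[R[i]]_d) : Prop :=
  forall X : 'M[R[i]]_d, \tr (Lambda X) = \tr X.

(* Maximally incoherent operations (MIO); all the other usual classes of free
   operations (IO, SIO, GIO, PIO) are contained in this one. *)
Definition free_operation (R : realType) (d : nat) (e : 'I_d -> 'cV[R[i]]_d)
    (Lambda : {linear 'M[R[i]]_d -> 'M[R[i]]_d}) : Prop :=
  [/\ completely_positive Lambda,
      trace_preserving Lambda
    & forall sigma, incoherent e sigma -> incoherent e (Lambda sigma)].

Definition deterministically_purifiable (R : realType) (d : nat)
    (e : 'I_d -> 'cV[R[i]]_d) (rho : 'M[R[i]]_d) : Prop :=
  exists Lambda : {linear 'M[R[i]]_d -> 'M[R[i]]_d},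
    free_operation e Lambda /\ pure_coherent e (Lambda rho).

(* Main.v *)
Require Import Defs.
From mathcomp Require Import all_boot all_order all_algebra.
From mathcomp Require Import ring sesquilinear spectral.
From mathcomp Require Import reals complex.

Import Order.TTheory GRing.Theory Num.Theory.
Local Open Scope ring_scope.
Local Open Scope sesquilinear_scope.
Local Open Scope complex_scope.

(* A rank-one projector is an extreme point of the set of density operators. A
   purifying map sends rho to the mixture
   lambda Lambda(sigma) + (1 - lambda) Lambda(tau) of density operators; if this
   is the projector on psi, then Lambda(sigma) is that projector as well. But
   Lambda(sigma) is incoherent, because sigma is. *)

Section Adjoint.
Context {C : numClosedFieldType}.

Lemma adjmxM m n p (A : 'M[C]_(m, n)) (B : 'M[C]_(n, p)) :
  (A *m B) ^t* = B ^t* *m A ^t*.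
Proof. by rewrite trmx_mul map_mxM. Qed.

Lemma adjmxD m n (A B : 'M[C]_(m, n)) : (A + B) ^t* = A ^t* + B ^t*.
Proof. by rewrite linearD map_mxD. Qed.

Lemma adjmxZ m n (a : C) (A : 'M[C]_(m, n)) : (a *: A) ^t* = a^* *: A ^t*.
Proof. by rewrite linearZ map_mxZ. Qed.

Lemma mxDE m n (A B : 'M[C]_(m, n)) i j : (A + B) i j = A i j + B i j.
Proof. by rewrite mxE. Qed.

Lemma mxZE m n (a : C) (A : 'M[C]_(m, n)) i j : (a *: A) i j = a * A i j.
Proof. by rewrite mxE. Qed.

(** A nonconstant real affine function takes negative values. *)
Lemma ge0_real_affine_eq0 (q z : C) :
  (forall s : C, s \is Num.real -> 0 <= q + s * z) -> z = 0.
Proof.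
move=> H.
have q0 : 0 <= q by have := H 0 (rpred0 _); rewrite mul0r addr0.
(* [z] is the difference of [q + z] and [q], both nonnegative, hence real; the witness chosen next
   is then real too. *)
have zR : z \is Num.real.
  have := H 1 (rpred1 _); rewrite mul1r => /ger0_real qzR.
  by rewrite -[z](addKr q) addrC rpredB // ger0_real.
apply/eqP/contraT => z0.
(* At this [s] the function takes the value -1. *)
have /H : - (q + 1) / z \is Num.real.
  by rewrite rpred_div // rpredN rpredD ?rpred1 // ger0_real.
by rewrite divfK // opprD addrA subrr add0r oppr_ge0 ler10.
Qed.

(** Real [t] give [y + x = 0] and purely imaginary [t] give [y - x = 0]. *)
Lemma ge0_sesqui_affine_eq0 (q x y : C) :
  (forall t : C, 0 <= q + (t * y + t^* * x)) -> x = 0 /\ y = 0.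
Proof.
move=> H.
have yx0 : y + x = 0.
  apply: (@ge0_real_affine_eq0 q) => s sR.
  by have := H s; rewrite (conj_Creal sR) -mulrDr.
have ix0 : 'i * (y - x) = 0.
  apply: (@ge0_real_affine_eq0 q) => s sR; have := H (s * 'i).
  rewrite rmorphM /= conjCi (conj_Creal sR).
  suff -> : s * 'i * y + s * - 'i * x = s * ('i * (y - x)) by [].
  by ring.
have yx : y = x.
  by apply/eqP; rewrite -subr_eq0; move/eqP: ix0; rewrite mulf_eq0 (negPf (neq0Ci _)).
have : x *+ 2 == 0 by rewrite mulr2n -{1}yx yx0.
by rewrite yx mulrn_eq0 /= => /eqP.
Qed.

End Adjoint.

Section Psd.
Context {R : realType} {n : nat}.
Implicit Types A B : 'M[R[i]]_n.

(** In the expansion of the form at [w + t *: v] the term in the squared modulus of [t] vanishes.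
    What remains is affine in [t] and its conjugate, yet nonnegative for all [t]. *)
Lemma psdmx_isotropic A (v w : 'cV[R[i]]_n) : psdmx A ->
  (v ^t* *m A *m v) ord0 ord0 = 0 ->
  (v ^t* *m A *m w) ord0 ord0 = 0 /\ (w ^t* *m A *m v) ord0 ord0 = 0.
Proof.
move=> psdA v0.
apply: (@ge0_sesqui_affine_eq0 _ ((w ^t* *m A *m w) ord0 ord0)) => t.
have := psdA (w + t *: v).
rewrite adjmxD adjmxZ !(mulmxDl, mulmxDr) -!(scalemxAl, scalemxAr).
by rewrite !(mxDE, mxZE) v0 !mulr0 addr0 -addrA [X in _ + X]addrC.
Qed.

Lemma psdmx_isotropic_ker A (v : 'cV[R[i]]_n) : psdmx A ->
  (v ^t* *m A *m v) ord0 ord0 = 0 -> A *m v = 0 /\ v ^t* *m A = 0.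
Proof.
move=> psdA v0; split; apply/matrixP => i j.
  have [_] := psdmx_isotropic A v (delta_mx i ord0) psdA v0.
  rewrite trmx_delta map_delta_mx -mulmxA -rowE mxE => Av.
  by rewrite (ord1 j) Av mxE.
have [vA _] := psdmx_isotropic A v (delta_mx j ord0) psdA v0.
by move: vA; rewrite -colE mxE (ord1 i) => ->; rewrite mxE.
Qed.

(** With P the projector on [psi] and [Q] its complement, positivity forces [A] to vanish on the
    range of [Q] from both sides. Hence A = PAP, a multiple of P, and the trace fixes the factor as
    1. *)
Lemma pure_extreme A B (psi : 'cV[R[i]]_n) (a b : R[i]) :
  psi ^t* *m psi = 1%:M -> psdmx A -> psdmx B -> \tr A = 1 ->
  0 < a -> 0 <= b -> a *: A + b *: B = psi *m psi ^t* -> A = psi *m psi ^t*.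
Proof.
move=> psi1 psdA psdB trA a0 b0 AB.
pose Q := 1%:M - psi *m psi ^t*.
have QpP : psi ^t* *m Q = 0.
  by rewrite mulmxBr mulmx1 mulmxA psi1 mul1mx subrr.
have AQv (v : 'cV[R[i]]_n) : A *m (Q *m v) = 0 /\ (Q *m v) ^t* *m A = 0.
  apply: psdmx_isotropic_ker => //; set u := Q *m v.
  have u0 : psi ^t* *m u = 0 by rewrite mulmxA QpP mul0mx.
  (* Two nonnegative terms with sum zero both vanish, and [a] is nonzero. *)
  have : (u ^t* *m (a *: A + b *: B) *m u) ord0 ord0 = 0.
    by rewrite AB -!mulmxA u0 !mulmx0 mxE.
  rewrite mulmxDr mulmxDl -!(scalemxAl, scalemxAr) mxDE !mxZE => /eqP.
  rewrite paddr_eq0 ?mulr_ge0 ?(ltW a0) //; do ?[exact: psdA|exact: psdB].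
  by rewrite mulf_eq0 gt_eqF //= => /andP[/eqP].
have AQ : A *m Q = 0.
  apply/matrixP => i j; have [] := AQv (delta_mx j ord0).
  by rewrite mulmxA -colE => /matrixP/(_ i ord0); rewrite !mxE.
have QA : Q *m A = 0.
  have Qh : Q ^t* = Q.
    by rewrite /Q linearB map_mxB /= trmx1 map_mx1 adjmxM trmxCK.
  apply/matrixP => i j; have [_] := AQv (delta_mx i ord0).
  rewrite adjmxM Qh trmx_delta map_delta_mx -mulmxA -rowE.
  by move=> /matrixP/(_ ord0 j); rewrite !mxE.
have AE : A = A *m (psi *m psi ^t*).
  by apply/eqP; rewrite -subr_eq0 -{1}[A]mulmx1 -mulmxBr AQ.
have EA : A = psi *m psi ^t* *m A.
  by apply/eqP; rewrite -subr_eq0 -{1}[A]mul1mx -mulmxBl QA.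
(* In PAP the middle factor [psi ^t* *m A *m psi] is a 1 x 1 matrix, so it acts as a scalar. *)
have [c Ac] : exists c, A = c *: (psi *m psi ^t*).
  exists ((psi ^t* *m A *m psi) ord0 ord0).
  rewrite {1}AE {1}EA !mulmxA -[psi *m _ *m A]mulmxA -[psi *m _ *m psi]mulmxA.
  by rewrite {1}[_ *m A *m psi]mx11_scalar mul_mx_scalar scalemxAl.
have := trA; rewrite {1}Ac mxtraceZ mxtrace_mulC psi1 mxtrace1 mulr1 => c1.
by rewrite Ac c1 scale1r.
Qed.

(** This is the case [k = 1] of complete positivity. The size of a 1 x 1 block matrix is a sum over
    one index rather than literally [n], so quadratic forms are carried across by [form1]. *)
Lemma completely_positive_psd (Lambda : 'M[R[i]]_n -> 'M[R[i]]_n) A :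
  completely_positive Lambda -> psdmx A -> psdmx (Lambda A).
Proof.
move=> cp psdA.
have adj_mxcol (k : nat) (v : 'I_k -> 'cV[R[i]]_n) :
    (\mxcol_a v a) ^t* = \mxrow_a (v a) ^t*.
  by rewrite tr_mxcol; apply/matrixP => i j; rewrite !mxE.
have form1 (B : 'M[R[i]]_n) (v : 'I_1 -> 'cV[R[i]]_n) :
    (\mxcol_a v a) ^t* *m (\mxblock_(a < 1, b < 1) B) *m (\mxcol_a v a)
    = (v ord0) ^t* *m B *m v ord0.
  by rewrite adj_mxcol mul_mxrow_mxblock mul_mxrow_mxcol !big_ord1.
have psdX : psdmx (\mxblock_(a < 1, b < 1) A).
  by move=> v; rewrite -[v]submxcolK form1; apply: psdA.
move=> v; have := cp 1%N _ psdX (\mxcol_(a < 1) v).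
rewrite /ampliation.
under eq_mxblock do rewrite mxblockK.
by rewrite form1.
Qed.

End Psd.

Theorem theorem1 (R : realType) (d : nat) (e : 'I_d -> 'cV[R[i]]_d)
    (he : orthonormal_basis e)
    (rho sigma tau : 'M[R[i]]_d) (lambda : R)
    (hrho : density rho)
    (hlambda : 0 < lambda < 1)
    (hsigma : incoherent e sigma)
    (htau : coherent e tau)
    (hmix : rho = lambda%:C *: sigma + (1 - lambda)%:C *: tau) :
  ~ deterministically_purifiable e rho.
Proof.
move=> [Lambda [[cp _ mio] [[psi [psi1 rhoE]] [_ rho_coh]]]].
have /andP[lambda_gt0 lambda_lt1] := hlambda.
have inc := mio _ hsigma; apply: rho_coh; rewrite rhoE.
have [[psd_sigma tr_sigma] _] := inc.
(* Extremality replaces the projector by [Lambda sigma], whose incoherence is [inc]; the remaining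
   goals are the hypotheses of extremality. *)
rewrite -(pure_extreme (Lambda sigma) (Lambda tau) psi
            lambda%:C (1 - lambda)%:C) //.
- by apply: completely_positive_psd => //; case: htau => -[].
- by rewrite ltcR.
- by rewrite lecR subr_ge0 ltW.
- by rewrite -rhoE hmix linearD !linearZ.
Qed.
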